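(* Let $q\in\mathbb{C}$ with $0<|q|<1$, and let $x,y,z,w\in\mathbb{C}$ satisfy $|q|<|x|<1$, $|q|<|y|<1$, $|q|<|z|<1$, $|q|<|w|<1$, $|xy|>|q|$, and $w\neq zq^{-r}$ for all $r\in\mathbb{N}$. Then $$A(x,y,zq,w)-\frac{q^2}{xy^2wz}A\left(\frac{q}{x},\frac{q}{y},\frac{q}{z},\frac{q}{w}\right)=\frac{1}{y}L(x,w)L^*(y,z)-\frac{1}{y}L\left(x,\frac{w}{z}\right)L^*(xy,z)+\frac{w}{yz}L\left(\frac{q}{y},\frac{w}{z}\right)L^*(xy,w).$$
   Context: $\mathbb{N}=\{0,1,2,\dots\}$, and $q$ is complex with $0<|q|<1$. The double Lambert series is $$A(x,y,z,w)=A(x,y,z,w;q):=\sum_{n=0}^\infty\sum_{m\ge n}\frac{x^n y^m}{(1-wq^n)(1-zq^m)},$$ defined for $|xy|<1$, $|y|<1$, $z\ne q^{-r}$, $w\neq q^{-r}$ ($r\in\mathbb{N}$). The Lambert series is $$L(x,y_1,\dots,y_k)=L(x,y_1,\dots,y_k;q):=\sum_{n=0}^\infty\frac{x^n}{(1-y_1q^n)\cdots(1-y_kq^n)},$$ defined for $|x|<1$ and $y_i\ne q^{-r}$ ($r\in\mathbb{N}$). The bilateral Lambert series is $$L^*(x,y)=L^*(x,y;q):=\sum_{n\in\mathbb{Z}}\frac{x^n}{1-yq^n},$$ defined for $|q|<|x|<1$ and $y$ not an integer power of $q$. *)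

(* Defs.v *)
From Stdlib Require Import Reals ZArith List.
From Coquelicot Require Import Coquelicot.
Import ListNotations.
Open Scope C_scope.

(* As with [RInt] and [is_RInt]: meaningful when the series converges,
   unspecified otherwise. *)
Definition CSeries (a : nat -> C) : C :=
  iota (T := C_CompleteNormedModule)
    (@is_series C_AbsRing C_CompleteNormedModule a).

Lemma CSeries_unique (a : nat -> C) (s : C) :
  @is_series C_AbsRing C_CompleteNormedModule a s -> CSeries a = s.
Proof.
  intros H; unfold CSeries.
  exact (@iota_filterlim_locally C_AbsRing C_CompleteNormedModule nat eventually
           _ (@sum_n C_AbelianMonoid a) s H).
Qed.

(* The sum over all m >= n. *)
Definition CSeries_from (n : nat) (a : nat -> C) : C :=
  CSeries (fun k => a (n + k)%nat).

(* Convergence of a bilateral series means convergence of both halves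
   n >= 0 and n <= -1, not of symmetric partial sums. *)
Definition CSeries_bilateral (a : Z -> C) : C :=
  CSeries (fun n => a (Z.of_nat n)) + CSeries (fun n => a (- Z.of_nat (S n))%Z).

Definition CpowZ (x : C) (n : Z) : C :=
  match n with
  | Z0 => 1
  | Zpos p => x ^ Pos.to_nat p
  | Zneg p => / x ^ Pos.to_nat p
  end.

Definition double_lambert (q x y z w : C) : C :=
  CSeries (fun n =>
    CSeries_from n (fun m =>
      x ^ n * y ^ m / ((1 - w * q ^ n) * (1 - z * q ^ m)))).

(* The list is [y_1; ...; y_k]. *)
Definition lambert (q x : C) (ys : list C) : C :=
  CSeries (fun n =>
    x ^ n / fold_right Cmult 1 (map (fun y => 1 - y * q ^ n) ys)).

Definition bilateral_lambert (q x y : C) : C :=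
  CSeries_bilateral (fun n => CpowZ x n / (1 - y * CpowZ q n)).

(* Main.v *)
Require Import Defs.
From Stdlib Require Import Reals ZArith List.
From Coquelicot Require Import Coquelicot.
From Stdlib Require Import Lra Lia FunctionalExtensionality.
Import ListNotations.
Open Scope C_scope.

(** Put [g n = x ^ n / (1 - w q ^ n)] and [h m = y ^ m / (1 - z q ^ m)] for integers [n]
    and [m]. Shifting [m] by one in the first double series, and reflecting
    [(n, m)] to [(- n - 1, - m - 1)] in the second, shows that [y] times the left-hand
    side is the sum of [g n * h m] over [n >= 0, m > n] minus its sum over
    [n < 0, m <= n] ([double_lambert_upper], [double_lambert_lower]). Completing the
    first region to all of [n >= 0], the difference equals
    [(sum of g over n >= 0) * (sum of h)] minus the sum of [g n * h m] over the half
    plane [m <= n] ([half_plane_resummation]). The product is [L(x, w) L*(y, z)].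

    The half plane is summed along its diagonals [m = n - k], [k >= 0]. On a diagonal,
    partial fractions ([lambert_term_mult]) write [g n * h (n - k)] as a combination,
    with coefficients depending on [k] only, of the terms of [L*(xy, w)] and of
    translated terms of [L*(xy, z)]; a bilateral sum is invariant under translation, and
    summing the coefficients over [k] gives the two Lambert series with parameter
    [w / z] ([diagonal_sum]).

    All rearrangements rest on the hypotheses [|q| < |x|, |y|, |z|, |w| < 1]: they
    make [g] and [h] decay geometrically in both directions ([lambert_term_decay]), so
    that the double family is dominated by a product of two convergent series
    ([geom_decay_mul_shift], [CSeries_swap]). *)

(** * Absolutely convergent complex series *)

(** All the series below converge absolutely, and unlike plain convergence this notion is
    stable under domination. *)
Definition summable (a : nat -> C) : Prop := ex_series (fun n => Cmod (a n)).

Lemma CSeries_ext (a b : nat -> C) : (forall n, a n = b n) -> CSeries a = CSeries b.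
Proof. intros H; f_equal; apply functional_extensionality, H. Qed.

Lemma summable_ext (a b : nat -> C) : (forall n, a n = b n) -> summable a -> summable b.
Proof. intros H; apply ex_series_ext; intros n; now rewrite H. Qed.

Lemma CSeries_correct (a : nat -> C) : summable a ->
  @is_series C_AbsRing C_CompleteNormedModule a (CSeries a).
Proof.
  intros H.
  destruct (@ex_series_le C_AbsRing C_CompleteNormedModule a (fun n => Cmod (a n)))
    as [s Hs]; [intros n; apply Rle_refl | exact H |].
  now rewrite (CSeries_unique _ _ Hs).
Qed.

Lemma summable_le (a : nat -> C) (b : nat -> R) :
  (forall n, (Cmod (a n) <= b n)%R) -> ex_series b -> summable a.
Proof.
  intros H Hb.
  apply (@ex_series_le R_AbsRing R_CompleteNormedModule _ b); [|exact Hb].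
  intros n; change (Rabs (Cmod (a n)) <= b n)%R.
  rewrite Rabs_pos_eq by apply Cmod_ge_0; apply H.
Qed.

Lemma summable_scal (c : C) (a : nat -> C) : summable a -> summable (fun n => c * a n).
Proof.
  intros Ha; apply (summable_le _ (fun n => Cmod c * Cmod (a n))%R).
  - intros n; rewrite Cmod_mult; apply Rle_refl.
  - exact (@ex_series_scal R_AbsRing R_NormedModule (Cmod c) _ Ha).
Qed.

Lemma summable_S (a : nat -> C) : summable (fun n => a (S n)) <-> summable a.
Proof. symmetry; exact (ex_series_incr_1 (fun n => Cmod (a n))). Qed.

Lemma CSeries_plus (a b : nat -> C) : summable a -> summable b ->
  CSeries (fun n => a n + b n) = CSeries a + CSeries b.
Proof.
  intros Ha Hb; apply CSeries_unique.
  exact (is_series_plus _ _ _ _ (CSeries_correct _ Ha) (CSeries_correct _ Hb)).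
Qed.

Lemma CSeries_scal (c : C) (a : nat -> C) : summable a ->
  CSeries (fun n => c * a n) = c * CSeries a.
Proof.
  intros Ha; apply CSeries_unique.
  exact (is_series_scal c _ _ (CSeries_correct _ Ha)).
Qed.

Lemma CSeries_S (a : nat -> C) : summable a ->
  CSeries a = a 0%nat + CSeries (fun n => a (S n)).
Proof.
  intros Ha; apply CSeries_unique, is_series_decr_1.
  replace (plus _ _) with (CSeries (fun n => a (S n))).
  - now apply (CSeries_correct (fun n => a (S n))), summable_S.
  - change (CSeries (fun n => a (S n))
      = a 0%nat + CSeries (fun n => a (S n)) + - a 0%nat); ring.
Qed.

Lemma Cmod_CSeries_le (a : nat -> C) (b : nat -> R) :
  (forall n, (Cmod (a n) <= b n)%R) -> ex_series b -> (Cmod (CSeries a) <= Series b)%R.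
Proof.
  intros H Hb.
  pose proof (CSeries_correct _ (summable_le _ _ H Hb)) as Hs.
  pose proof (Series_correct _ Hb) as Ht.
  apply (is_lim_seq_le (fun n => Cmod (@sum_n C_AbelianMonoid a n)) (sum_n b)
           (Cmod (CSeries a)) (Series b)).
  - intros n; induction n as [|n IH].
    + rewrite !sum_O; apply H.
    + rewrite !sum_Sn; eapply Rle_trans; [apply Cmod_triangle|].
      apply Rplus_le_compat; [exact IH | apply H].
  - exact (filterlim_comp _ _ _ _ _ _ _ _ Hs
             (@filterlim_norm C_AbsRing C_CompleteNormedModule (CSeries a))).
  - exact Ht.
Qed.

Lemma Series_tail_lim (a : nat -> R) : ex_series a ->
  is_lim_seq (fun N => Series (fun n => a (N + n)%nat)) 0%R.
Proof.
  intros Ha; apply is_lim_seq_incr_1.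
  apply (is_lim_seq_ext (fun N => Series a - sum_n a N)%R).
  - intros N; rewrite (Series_incr_n a (S N)); [|lia|exact Ha].
    simpl; rewrite sum_n_Reals; lra.
  - replace (Finite 0) with (Rbar_minus (Series a) (Series a))
      by (simpl; f_equal; ring).
    apply is_lim_seq_minus'; [apply is_lim_seq_const|].
    exact (Series_correct _ Ha).
Qed.

(** * Interchange of summations *)

Section Fubini.

Variables (F : nat -> nat -> C) (a b : nat -> R).
Hypotheses (a_ex : ex_series a) (b_ex : ex_series b).
Hypothesis F_le : forall n k, (Cmod (F n k) <= a n * b k)%R.

Lemma summable_row n : summable (F n).
Proof.
  apply (summable_le _ (fun k => a n * b k)%R); [apply F_le|].
  exact (@ex_series_scal R_AbsRing R_NormedModule (a n) _ b_ex).
Qed.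

Lemma Cmod_row_sum_le n : (Cmod (CSeries (F n)) <= a n * Series b)%R.
Proof.
  rewrite <- Series_scal_l; apply Cmod_CSeries_le; [apply F_le|].
  exact (@ex_series_scal R_AbsRing R_NormedModule (a n) _ b_ex).
Qed.

Lemma summable_row_sums : summable (fun n => CSeries (F n)).
Proof.
  apply (summable_le _ (fun n => a n * Series b)%R); [apply Cmod_row_sum_le|].
  now apply ex_series_scal_r.
Qed.

Lemma iterated_sum_scal (c : C) :
  CSeries (fun n => CSeries (fun k => c * F n k))
  = c * CSeries (fun n => CSeries (F n)).
Proof.
  rewrite <- CSeries_scal by apply summable_row_sums.
  apply CSeries_ext; intros n; apply CSeries_scal, summable_row.
Qed.

Lemma Cmod_iterated_sum_le :
  (Cmod (CSeries (fun n => CSeries (F n))) <= Series a * Series b)%R.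
Proof.
  rewrite <- Series_scal_r; apply Cmod_CSeries_le; [apply Cmod_row_sum_le|].
  now apply ex_series_scal_r.
Qed.

End Fubini.

(** Removing the first row changes both iterated sums by the same amount. *)
Lemma iterated_sums_peel (F : nat -> nat -> C) (a b : nat -> R) :
  ex_series a -> ex_series b ->
  (forall n k, (Cmod (F n k) <= a n * b k)%R) ->
  CSeries (fun n => CSeries (F n)) - CSeries (fun k => CSeries (fun n => F n k))
  = CSeries (fun n => CSeries (F (S n)))
    - CSeries (fun k => CSeries (fun n => F (S n) k)).
Proof.
  intros Ha Hb HF.
  assert (HFt : forall k n, (Cmod (F n k) <= b k * a n)%R)
    by (intros; rewrite Rmult_comm; apply HF).
  assert (Ha' : ex_series (fun n => a (S n))) by now apply (ex_series_incr_1 a).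
  rewrite (CSeries_S (fun n => CSeries (F n))) by now apply (summable_row_sums F a b).
  rewrite (CSeries_ext (fun k => CSeries (fun n => F n k))
             (fun k => F 0%nat k + CSeries (fun n => F (S n) k))).
  - rewrite CSeries_plus.
    + ring.
    + now apply (summable_row F a b).
    + now apply (summable_row_sums (fun k n => F (S n) k) b (fun n => a (S n))).
  - intros k; apply (CSeries_S (fun n => F n k)).
    now apply (summable_row (fun k n => F n k) b a).
Qed.

(** By [iterated_sums_peel] the difference of the two iterated sums is that of the
    family without its first [N] rows, and both sums of the latter are bounded by
    a tail of [a] times the sum of [b]. *)
Lemma CSeries_swap (F : nat -> nat -> C) (a b : nat -> R) :
  ex_series a -> ex_series b ->
  (forall n k, (Cmod (F n k) <= a n * b k)%R) ->
  CSeries (fun n => CSeries (F n)) = CSeries (fun k => CSeries (fun n => F n k)).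
Proof.
  intros Ha Hb HF.
  set (D := fun N : nat => CSeries (fun n => CSeries (F (N + n)%nat))
                   - CSeries (fun k => CSeries (fun n => F (N + n)%nat k))).
  assert (Htail : forall N, ex_series (fun n => a (N + n)%nat))
    by (intros N; now apply (ex_series_incr_n a)).
  assert (HD : forall N, D 0%nat = D N).
  { induction N as [|N IH]; [reflexivity|].
    rewrite IH; unfold D.
    rewrite (iterated_sums_peel (fun n => F (N + n)%nat) (fun n => a (N + n)%nat) b); auto.
    apply (f_equal2 Cminus); apply CSeries_ext; intros n; apply CSeries_ext; intros k;
      f_equal; lia. }
  assert (Hle : forall N,
    (Cmod (D 0%nat) <= Series (fun n => a (N + n)%nat) * (2 * Series b))%R).
  { intros N; rewrite (HD N); unfold D, Cminus.
    eapply Rle_trans; [apply Cmod_triangle|]; rewrite Cmod_opp.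
    pose proof (Cmod_iterated_sum_le (fun n => F (N + n)%nat) (fun n => a (N + n)%nat) b
                  (Htail N) Hb (fun n k => HF _ _)).
    assert (forall k n, (Cmod (F (N + n)%nat k) <= b k * a (N + n)%nat)%R)
      by (intros; rewrite Rmult_comm; apply HF).
    pose proof (Cmod_iterated_sum_le (fun k n => F (N + n)%nat k) b
                  (fun n => a (N + n)%nat) Hb (Htail N) ltac:(assumption)).
    simpl in *; lra. }
  assert (H0 : (Cmod (D 0%nat) <= 0)%R).
  { apply (is_lim_seq_le _ _ (Cmod (D 0%nat)) 0%R Hle).
    - apply is_lim_seq_const.
    - replace (Finite 0) with (Rbar_mult 0 (2 * Series b)%R)
        by (simpl; f_equal; ring).
      apply (is_lim_seq_scal_r _ (2 * Series b)%R 0%R), Series_tail_lim, Ha. }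
  assert (E : D 0%nat = 0) by (apply Cmod_eq_0, Rle_antisym; [exact H0 | apply Cmod_ge_0]).
  unfold D in E; simpl in E.
  apply (f_equal (Cplus (CSeries (fun k => CSeries (fun n => F n k))))) in E.
  ring_simplify in E; exact E.
Qed.

(** * Bilateral series *)

Definition bisummable (a : Z -> C) : Prop :=
  summable (fun n => a (Z.of_nat n)) /\ summable (fun n => a (- Z.of_nat (S n))%Z).

Lemma CSeries_bilateral_ext (a b : Z -> C) :
  (forall n, a n = b n) -> CSeries_bilateral a = CSeries_bilateral b.
Proof. intros H; f_equal; apply functional_extensionality, H. Qed.

(** Moving the cut point by one moves a single term from one half to the other. *)
Lemma CSeries_bilateral_split (a : Z -> C) : bisummable a -> forall N : Z,
  summable (fun j => a (N + Z.of_nat j)%Z) /\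
  summable (fun j => a (N - Z.of_nat (S j))%Z) /\
  CSeries_bilateral a
  = CSeries (fun j => a (N + Z.of_nat j)%Z) + CSeries (fun j => a (N - Z.of_nat (S j))%Z).
Proof.
  intros [Hp Hn]; apply Z.bi_induction; [now intros ? ? -> | easy |].
  intros N.
  set (X := fun j => a (N + Z.of_nat j)%Z).
  set (Y := fun j => a (Z.succ N - Z.of_nat (S j))%Z).
  replace (fun j => a (Z.succ N + Z.of_nat j)%Z) with (fun j => X (S j))
    by (apply functional_extensionality; intros j; unfold X; f_equal; lia).
  replace (fun j => a (N - Z.of_nat (S j))%Z) with (fun j => Y (S j))
    by (apply functional_extensionality; intros j; unfold Y; f_equal; lia).
  assert (E0 : X 0%nat = Y 0%nat) by (unfold X, Y; f_equal; lia).
  rewrite !(summable_S X), !(summable_S Y).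
  split; intros (HX & HY & ->); (split; [easy|split; [easy|]]);
    rewrite (CSeries_S X HX), (CSeries_S Y HY), E0; ring.
Qed.

Lemma CSeries_bilateral_shift (a : Z -> C) (k : Z) : bisummable a ->
  bisummable (fun n => a (n - k)%Z) /\
  CSeries_bilateral (fun n => a (n - k)%Z) = CSeries_bilateral a.
Proof.
  intros Ha.
  destruct (CSeries_bilateral_split a Ha (- k)%Z) as (Hp & Hn & ->).
  assert (Ep : forall n, a (- k + Z.of_nat n)%Z = a (Z.of_nat n - k)%Z)
    by (intros; f_equal; lia).
  assert (En : forall n, a (- k - Z.of_nat (S n))%Z = a (- Z.of_nat (S n) - k)%Z)
    by (intros; f_equal; lia).
  split; [split|].
  - exact (summable_ext _ _ Ep Hp).
  - exact (summable_ext _ _ En Hn).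
  - unfold CSeries_bilateral; now rewrite (CSeries_ext _ _ Ep), (CSeries_ext _ _ En).
Qed.

Lemma CSeries_bilateral_lin (c d : C) (a b : Z -> C) : bisummable a -> bisummable b ->
  CSeries_bilateral (fun n => c * a n + d * b n)
  = c * CSeries_bilateral a + d * CSeries_bilateral b.
Proof.
  intros [Hap Han] [Hbp Hbn]; unfold CSeries_bilateral.
  rewrite (CSeries_plus (fun n => c * a (Z.of_nat n)) (fun n => d * b (Z.of_nat n)))
    by now apply summable_scal.
  rewrite (CSeries_plus (fun n => c * a (- Z.of_nat (S n))%Z)
             (fun n => d * b (- Z.of_nat (S n))%Z))
    by now apply (summable_scal _ (fun n => _ (- Z.of_nat (S n))%Z)).
  rewrite (CSeries_scal c (fun n => a (Z.of_nat n)) Hap),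
    (CSeries_scal d (fun n => b (Z.of_nat n)) Hbp),
    (CSeries_scal c _ Han), (CSeries_scal d _ Hbn).
  ring.
Qed.

(** The class of bilateral sequences containing the terms of [bilateral_lambert], with a
    bound symmetric in [n] and [- n] so that one rate serves both halves. *)
Definition geom_decay (a : Z -> C) : Prop :=
  exists M r : R, (0 <= r < 1)%R /\
    forall n, (Cmod (a n) <= M * r ^ Z.abs_nat n)%R.

Lemma ex_series_scal_geom (M r : R) : (0 <= r < 1)%R -> ex_series (fun n => M * r ^ n)%R.
Proof.
  intros Hr; apply (@ex_series_scal R_AbsRing R_NormedModule M (fun n => r ^ n)%R).
  apply ex_series_geom; rewrite Rabs_pos_eq; lra.
Qed.

Lemma pow_le_pow (r : R) (m n : nat) : (0 <= r <= 1)%R -> (m <= n)%nat ->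
  (r ^ n <= r ^ m)%R.
Proof.
  intros Hr Hmn; replace n with (m + (n - m))%nat by lia; rewrite pow_add.
  rewrite <- (Rmult_1_r (r ^ m)) at 2.
  apply Rmult_le_compat_l; [apply pow_le; lra|].
  rewrite <- (pow1 (n - m)); apply pow_incr; lra.
Qed.

Lemma geom_decay_bisummable (a : Z -> C) : geom_decay a -> bisummable a.
Proof.
  intros (M & r & Hr & H); split.
  - apply (summable_le _ (fun n => M * r ^ n)%R); [|now apply ex_series_scal_geom].
    intros n; specialize (H (Z.of_nat n)); now rewrite Zabs2Nat.id in H.
  - apply (summable_le _ (fun n => M * r ^ S n)%R).
    + intros n; specialize (H (- Z.of_nat (S n))%Z).
      now replace (Z.abs_nat (- Z.of_nat (S n))) with (S n) in H by lia.
    + apply (ex_series_incr_1 (fun n => M * r ^ n)%R), ex_series_scal_geom, Hr.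
Qed.

(** Since [|n| + |n - k|] dominates both [|n|] and [|k|], it is at least half their sum;
    with [s] the square root of a common decay rate the product is then bounded by a
    multiple of [s ^ |n| * s ^ |k|], which allows summation over [n] and [k] in either
    order. *)
Lemma geom_decay_mul_shift (g h : Z -> C) : geom_decay g -> geom_decay h ->
  exists a b : nat -> R, ex_series a /\ ex_series b /\
    forall (n k : Z) (i j : nat), (i <= Z.abs_nat n)%nat -> (j <= Z.abs_nat k)%nat ->
      (Cmod (g n * h (n - k)%Z) <= a i * b j)%R.
Proof.
  intros (M1 & r1 & Hr1 & Hg) (M2 & r2 & Hr2 & Hh).
  set (r := Rmax r1 r2).
  assert (Hr : (0 <= r < 1)%R) by (unfold r, Rmax; destruct Rle_dec; lra).
  assert (H1 : (0 <= M1)%R).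
  { generalize (Hg 0%Z) (Cmod_ge_0 (g 0%Z)); simpl; lra. }
  assert (H2 : (0 <= M2)%R).
  { generalize (Hh 0%Z) (Cmod_ge_0 (h 0%Z)); simpl; lra. }
  assert (Hs : (0 <= sqrt r < 1)%R).
  { split; [apply sqrt_pos|]; rewrite <- sqrt_1; apply sqrt_lt_1; lra. }
  exists (fun i => M1 * sqrt r ^ i)%R, (fun j => M2 * sqrt r ^ j)%R.
  split; [now apply ex_series_scal_geom|split; [now apply ex_series_scal_geom|]].
  intros n k i j Hi Hj; rewrite Cmod_mult.
  assert (Hg' : (Cmod (g n) <= M1 * r ^ Z.abs_nat n)%R).
  { eapply Rle_trans; [apply Hg|]; apply Rmult_le_compat_l; [exact H1|].
    apply pow_incr; split; [lra | apply Rmax_l]. }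
  assert (Hh' : (Cmod (h (n - k)%Z) <= M2 * r ^ Z.abs_nat (n - k))%R).
  { eapply Rle_trans; [apply Hh|]; apply Rmult_le_compat_l; [exact H2|].
    apply pow_incr; split; [lra | apply Rmax_r]. }
  eapply Rle_trans.
  { apply Rmult_le_compat; [apply Cmod_ge_0 | apply Cmod_ge_0 | exact Hg' | exact Hh']. }
  replace (M1 * r ^ Z.abs_nat n * (M2 * r ^ Z.abs_nat (n - k)))%R
    with (M1 * M2 * r ^ (Z.abs_nat n + Z.abs_nat (n - k)))%R by (rewrite pow_add; ring).
  replace (M1 * sqrt r ^ i * (M2 * sqrt r ^ j))%R
    with (M1 * M2 * sqrt r ^ (i + j))%R by (rewrite pow_add; ring).
  apply Rmult_le_compat_l; [now apply Rmult_le_pos|].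
  rewrite <- (pow2_sqrt r) at 1 by lra.
  rewrite <- pow_mult; apply pow_le_pow; [lra | lia].
Qed.

(** * Resummation along diagonals *)

(** For [n >= 0] the sum of [g n * h m] over [m > n] is the sum over all [m] minus the
    sum over [m <= n]; the subtracted terms and those with [n < 0] together fill the
    half plane [m <= n], which is then summed along the diagonals [m = n - k]. *)
Lemma half_plane_resummation (g h : Z -> C) : geom_decay g -> geom_decay h ->
  CSeries (fun n => CSeries (fun j =>
      g (Z.of_nat n) * h (Z.of_nat n + 1 + Z.of_nat j)%Z))
  - CSeries (fun n => CSeries (fun j =>
      g (- Z.of_nat (S n))%Z * h (- Z.of_nat (S n) - Z.of_nat j)%Z))
  = CSeries (fun n => g (Z.of_nat n)) * CSeries_bilateral h
    - CSeries (fun k => CSeries_bilateral (fun n => g n * h (n - Z.of_nat k)%Z)).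
Proof.
  intros Hg Hh.
  destruct (geom_decay_mul_shift g h Hg Hh) as (a & b & Ha & Hb & Hgh).
  destruct (geom_decay_bisummable g Hg) as [Hgs _].
  pose proof (CSeries_bilateral_split h (geom_decay_bisummable h Hh)) as Hsplit.
  set (Fp := fun n k => g (Z.of_nat n) * h (Z.of_nat n - Z.of_nat k)%Z).
  set (Fm := fun n k => g (- Z.of_nat (S n))%Z * h (- Z.of_nat (S n) - Z.of_nat k)%Z).
  assert (HFp : forall n k, (Cmod (Fp n k) <= a n * b k)%R) by (intros; apply Hgh; lia).
  assert (HFm : forall n k, (Cmod (Fm n k) <= a n * b k)%R) by (intros; apply Hgh; lia).
  assert (HFpt : forall k n, (Cmod (Fp n k) <= b k * a n)%R)
    by (intros; rewrite Rmult_comm; apply HFp).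
  assert (HFmt : forall k n, (Cmod (Fm n k) <= b k * a n)%R)
    by (intros; rewrite Rmult_comm; apply HFm).
  (* Row by row, the part [m > n] is the whole of [h] minus the part [m <= n]. *)
  assert (E1 : CSeries (fun n => CSeries (fun j =>
             g (Z.of_nat n) * h (Z.of_nat n + 1 + Z.of_nat j)%Z))
         = CSeries_bilateral h * CSeries (fun n => g (Z.of_nat n))
           + -1 * CSeries (fun n => CSeries (Fp n))).
  { pose proof (summable_row_sums Fp a b Ha Hb HFp) as HS.
    rewrite <- (CSeries_scal (-1) _ HS), <- (CSeries_scal _ _ Hgs).
    rewrite <- CSeries_plus by now apply summable_scal.
    apply CSeries_ext; intros n.
    destruct (Hsplit (Z.of_nat n + 1)%Z) as (H1 & H2 & E).
    rewrite (CSeries_scal (g (Z.of_nat n)) _ H1), E.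
    rewrite (CSeries_ext (Fp n) (fun j => g (Z.of_nat n) * h (Z.of_nat n + 1 - Z.of_nat (S j))%Z))
      by (intros j; unfold Fp; do 2 f_equal; lia).
    rewrite (CSeries_scal (g (Z.of_nat n)) _ H2).
    ring. }
  rewrite E1.
  change (CSeries (fun n => CSeries (fun j =>
             g (- Z.of_nat (S n))%Z * h (- Z.of_nat (S n) - Z.of_nat j)%Z)))
    with (CSeries (fun n => CSeries (Fm n))).
  rewrite (CSeries_swap Fp a b), (CSeries_swap Fm a b) by assumption.
  change (CSeries (fun k => CSeries_bilateral (fun n => g n * h (n - Z.of_nat k)%Z)))
    with (CSeries (fun k => CSeries (fun n => Fp n k) + CSeries (fun n => Fm n k))).
  rewrite (CSeries_plus (fun k => CSeries (fun n => Fp n k))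
             (fun k => CSeries (fun n => Fm n k))).
  - ring.
  - now apply (summable_row_sums (fun k n => Fp n k) b a).
  - now apply (summable_row_sums (fun k n => Fm n k) b a).
Qed.

(** * The terms of the bilateral Lambert series *)

Lemma CpowZ_of_nat (x : C) (n : nat) : CpowZ x (Z.of_nat n) = x ^ n.
Proof. destruct n; [reflexivity|]; simpl Z.of_nat; unfold CpowZ; now rewrite SuccNat2Pos.id_succ. Qed.

Lemma CpowZ_opp_of_nat (x : C) (n : nat) : CpowZ x (- Z.of_nat n) = / x ^ n.
Proof.
  destruct n; [simpl; field; apply RtoC_neq; lra|].
  simpl Z.of_nat; unfold CpowZ; simpl Z.opp; cbv iota.
  now rewrite SuccNat2Pos.id_succ.
Qed.

Lemma CpowZ_succ (x : C) (n : Z) : x <> 0 -> CpowZ x (Z.succ n) = x * CpowZ x n.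
Proof.
  intros Hx; destruct (Z_le_gt_dec 0 n) as [H|H].
  - rewrite <- (Z2Nat.id n H), <- Nat2Z.inj_succ, !CpowZ_of_nat; apply Cpow_S.
  - replace n with (- Z.of_nat (S (Z.to_nat (- n - 1))))%Z at 2 by lia.
    replace (Z.succ n) with (- Z.of_nat (Z.to_nat (- n - 1)))%Z by lia.
    rewrite !CpowZ_opp_of_nat, Cpow_S; field.
    split; [now apply Cpow_nz | exact Hx].
Qed.

Lemma CpowZ_sub_nat (x : C) (n : Z) (k : nat) : x <> 0 ->
  CpowZ x (n - Z.of_nat k) = CpowZ x n / x ^ k.
Proof.
  intros Hx; induction k as [|k IH].
  - rewrite Z.sub_0_r; simpl; field; apply RtoC_neq; lra.
  - replace (CpowZ x (n - Z.of_nat k)) with (x * CpowZ x (n - Z.of_nat (S k))) in IH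
      by (rewrite <- CpowZ_succ by exact Hx; f_equal; lia).
    pose proof (Cpow_nz x k Hx).
    apply (f_equal (fun t => / x * t)) in IH.
    rewrite Cmult_assoc, Cinv_l, Cmult_1_l in IH by exact Hx.
    rewrite IH, Cpow_S; field; auto.
Qed.

Lemma CpowZ_mult (x y : C) (n : Z) : x <> 0 -> y <> 0 ->
  CpowZ (x * y) n = CpowZ x n * CpowZ y n.
Proof.
  intros Hx Hy; destruct (Z_le_gt_dec 0 n) as [H|H].
  - rewrite <- (Z2Nat.id n H), !CpowZ_of_nat; apply Cpow_mult_l.
  - replace n with (- Z.of_nat (Z.to_nat (- n)))%Z by lia.
    rewrite !CpowZ_opp_of_nat, Cpow_mult_l; field.
    split; now apply Cpow_nz.
Qed.

Definition lambert_term (q p u : C) (n : Z) : C := CpowZ p n / (1 - u * CpowZ q n).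

Lemma Cmod_pos_neq_0 (u : C) : (0 < Cmod u)%R -> u <> 0.
Proof. intros H ->; rewrite Cmod_0 in H; lra. Qed.

Lemma Cmod_sub_ge (a b : C) : (Cmod a - Cmod b <= Cmod (a - b))%R.
Proof.
  generalize (Cmod_triangle (a - b) b); replace (a - b + b) with a by ring; lra.
Qed.

Section Annulus.

Variables q u : C.
Hypotheses (hq : (0 < Cmod q < 1)%R) (hu : (Cmod q < Cmod u < 1)%R).

Let q0 : q <> 0 := Cmod_pos_neq_0 q (proj1 hq).

Lemma lambert_den_ge (n : nat) : (1 - Cmod u <= Cmod (1 - u * q ^ n))%R.
Proof.
  eapply Rle_trans; [|apply Cmod_sub_ge].
  rewrite Cmod_1, Cmod_mult, Cmod_pow.
  pose proof (pow_le_pow (Cmod q) 0 n ltac:(lra) ltac:(lia)) as H; simpl in H.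
  pose proof (Rmult_le_compat_l (Cmod u) _ _ (Cmod_ge_0 u) H); lra.
Qed.

Lemma lambert_den_neg_ge (n : nat) : (Cmod u - Cmod q <= Cmod (q ^ S n - u))%R.
Proof.
  replace (q ^ S n - u) with (- (u - q ^ S n)) by ring; rewrite Cmod_opp.
  eapply Rle_trans; [|apply Cmod_sub_ge]; rewrite Cmod_pow.
  pose proof (pow_le_pow (Cmod q) 1 (S n) ltac:(lra) ltac:(lia)); rewrite pow_1 in *; lra.
Qed.

Lemma lambert_den_neq (n : nat) : 1 - u * q ^ n <> 0.
Proof. apply Cmod_pos_neq_0; generalize (lambert_den_ge n); lra. Qed.

Lemma lambert_den_neg_neq (n : nat) : q ^ S n - u <> 0.
Proof. apply Cmod_pos_neq_0; generalize (lambert_den_neg_ge n); lra. Qed.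

Lemma lambert_denZ_neq (n : Z) : 1 - u * CpowZ q n <> 0.
Proof.
  destruct (Z_le_gt_dec 0 n) as [H|H].
  - rewrite <- (Z2Nat.id n H), CpowZ_of_nat; apply lambert_den_neq.
  - replace n with (- Z.of_nat (S (Z.to_nat (- n - 1))))%Z by lia.
    rewrite CpowZ_opp_of_nat; set (m := Z.to_nat _).
    pose proof (Cpow_nz q (S m) q0) as Hm.
    replace (1 - u * / q ^ S m) with ((q ^ S m - u) * / q ^ S m) by (field; exact Hm).
    apply Cmult_neq_0; [apply lambert_den_neg_neq|].
    intros E; apply (f_equal (Cmult (q ^ S m))) in E.
    rewrite Cinv_r, Cmult_0_r in E by exact Hm; now apply C1_nz in E.
Qed.

Lemma lambert_term_of_nat (p : C) (n : nat) :
  lambert_term q p u (Z.of_nat n) = p ^ n / (1 - u * q ^ n).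
Proof. unfold lambert_term; now rewrite !CpowZ_of_nat. Qed.

(** Multiplying out [q ^ (n + 1)] exhibits the geometric decay in [q / p] at minus infinity. *)
Lemma lambert_term_neg (p : C) (n : nat) : p <> 0 ->
  lambert_term q p u (- Z.of_nat (S n)) = (q / p) ^ S n / (q ^ S n - u).
Proof.
  intros Hp; unfold lambert_term, Cdiv; rewrite !CpowZ_opp_of_nat.
  rewrite Cpow_mult_l, Cpow_inv by exact Hp.
  pose proof (Cpow_nz q (S n) q0); pose proof (Cpow_nz p (S n) Hp).
  pose proof (lambert_den_neg_neq n).
  set (Q := q ^ S n) in *; set (P := p ^ S n) in *; field; auto.
Qed.

Lemma lambert_term_decay (p : C) : (Cmod q < Cmod p < 1)%R ->
  geom_decay (lambert_term q p u).
Proof.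
  intros hp.
  assert (Hp : p <> 0) by (apply Cmod_pos_neq_0; lra).
  set (r := Rmax (Cmod p) (Cmod q / Cmod p)).
  assert (Hr1 : (Cmod q / Cmod p < 1)%R) by (apply Rlt_div_l; lra).
  assert (Hr0 : (0 < Cmod q / Cmod p)%R) by (apply Rdiv_lt_0_compat; lra).
  assert (Hpr : (Cmod p <= r)%R) by apply Rmax_l.
  assert (Hqr : (Cmod q / Cmod p <= r)%R) by apply Rmax_r.
  assert (Hr : (0 <= r < 1)%R) by (split; [lra | apply Rmax_lub_lt; lra]).
  pose proof (Rinv_0_lt_compat (1 - Cmod u) ltac:(lra)).
  pose proof (Rinv_0_lt_compat (Cmod u - Cmod q) ltac:(lra)).
  exists (/ (1 - Cmod u) + / (Cmod u - Cmod q))%R, r; split; [exact Hr|].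
  intros n; rewrite Rmult_comm; destruct (Z_le_gt_dec 0 n) as [Hn|Hn].
  - rewrite <- (Z2Nat.id n Hn); set (m := Z.to_nat n).
    rewrite lambert_term_of_nat, Zabs2Nat.id.
    rewrite Cmod_div by apply lambert_den_neq; rewrite Cmod_pow.
    apply Rmult_le_compat.
    + apply pow_le; lra.
    + left; apply Rinv_0_lt_compat; generalize (lambert_den_ge m); lra.
    + apply pow_incr; lra.
    + apply Rle_trans with (/ (1 - Cmod u))%R; [|lra].
      apply Rinv_le_contravar; [lra | apply lambert_den_ge].
  - replace n with (- Z.of_nat (S (Z.to_nat (- n - 1))))%Z by lia.
    set (m := Z.to_nat _).
    replace (Z.abs_nat (- Z.of_nat (S m))) with (S m) by lia.
    rewrite lambert_term_neg by exact Hp.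
    rewrite Cmod_div by apply lambert_den_neg_neq.
    rewrite Cmod_pow, Cmod_div by exact Hp.
    apply Rmult_le_compat.
    + apply pow_le; lra.
    + left; apply Rinv_0_lt_compat; generalize (lambert_den_neg_ge m); lra.
    + apply pow_incr; lra.
    + apply Rle_trans with (/ (Cmod u - Cmod q))%R; [|lra].
      apply Rinv_le_contravar; [lra | apply lambert_den_neg_ge].
Qed.

End Annulus.

(** * The double series *)

(** The condition on [v * q] bounds every denominator but the first away from zero, and the
    first term does not affect convergence; this covers [v = w / z], which may be larger
    than one in modulus. *)
Lemma lambert_summable (q p v : C) : (Cmod q < 1)%R -> (Cmod p < 1)%R ->
  (Cmod (v * q) < 1)%R -> summable (fun n => p ^ n / (1 - v * q ^ n)).
Proof.
  intros hq hp hv; apply (summable_S (fun n => p ^ n / (1 - v * q ^ n))).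
  pose proof (Cmod_ge_0 p); pose proof (Cmod_ge_0 q).
  apply (summable_le _ (fun n => / (1 - Cmod (v * q)) * Cmod p ^ n)%R);
    [|apply ex_series_scal_geom; lra].
  intros n; rewrite Rmult_comm.
  assert (Hge : (1 - Cmod (v * q) <= Cmod (1 - v * q ^ S n))%R).
  { eapply Rle_trans; [|apply Cmod_sub_ge].
    rewrite Cpow_S, Cmult_assoc, (Cmod_mult (v * q)), Cmod_1, Cmod_pow.
    pose proof (pow_le_pow (Cmod q) 0 n ltac:(lra) ltac:(lia)) as H1; simpl in H1.
    pose proof (Rmult_le_compat_l _ _ _ (Cmod_ge_0 (v * q)) H1); lra. }
  rewrite Cmod_div by (apply Cmod_pos_neq_0; lra).
  rewrite Cmod_pow; apply Rmult_le_compat.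
  - apply pow_le; lra.
  - left; apply Rinv_0_lt_compat; lra.
  - apply pow_le_pow; [lra | lia].
  - apply Rinv_le_contravar; [lra | exact Hge].
Qed.

Lemma lambert_single (q x v : C) :
  lambert q x [v] = CSeries (fun n => x ^ n / (1 - v * q ^ n)).
Proof. apply CSeries_ext; intros n; simpl; now rewrite Cmult_1_r. Qed.

Section DoubleSeries.

Variables q x y z w : C.
Hypotheses (hq : (0 < Cmod q < 1)%R)
  (hx : (Cmod q < Cmod x < 1)%R) (hy : (Cmod q < Cmod y < 1)%R)
  (hz : (Cmod q < Cmod z < 1)%R) (hw : (Cmod q < Cmod w < 1)%R).

Let q0 : q <> 0. Proof. apply Cmod_pos_neq_0; lra. Qed.
Let x0 : x <> 0. Proof. apply Cmod_pos_neq_0; lra. Qed.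
Let y0 : y <> 0. Proof. apply Cmod_pos_neq_0; lra. Qed.
Let z0 : z <> 0. Proof. apply Cmod_pos_neq_0; lra. Qed.
Let w0 : w <> 0. Proof. apply Cmod_pos_neq_0; lra. Qed.

Let decay_g := lambert_term_decay q w hq hw x hx.
Let decay_h := lambert_term_decay q z hq hz y hy.

(** Here [1 - z q q ^ m] is the denominator of the term of index [m + 1] of
    [lambert_term q y z], so the condition [m >= n] becomes [m > n]. *)
Lemma double_lambert_upper :
  double_lambert q x y (z * q) w
  = 1 / y * CSeries (fun n => CSeries (fun j =>
      lambert_term q x w (Z.of_nat n)
      * lambert_term q y z (Z.of_nat n + 1 + Z.of_nat j)%Z)).
Proof.
  destruct (geom_decay_mul_shift _ _ decay_g decay_h) as (a & b & Ha & Hb & Hgh).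
  rewrite <- (iterated_sum_scal _ a b); try assumption.
  - apply CSeries_ext; intros n; apply CSeries_ext; intros j.
    replace (Z.of_nat n + 1 + Z.of_nat j)%Z with (Z.of_nat (S (n + j))) by lia.
    rewrite !lambert_term_of_nat.
    pose proof (lambert_den_neq q w hq hw n) as Dw.
    pose proof (lambert_den_neq q z hq hz (S (n + j))) as Dz.
    rewrite !(Cpow_S _ (n + j)) in *.
    field; repeat split; try assumption.
  - intros n j.
    replace (Z.of_nat n + 1 + Z.of_nat j)%Z
      with (Z.of_nat n - (- Z.of_nat (S j)))%Z by lia.
    apply Hgh; lia.
Qed.

(** Reflecting [(n, m)] to [(- n - 1, - m - 1)] turns [q / w] and [q / z] back into
    [w] and [z]. *)
Lemma double_lambert_lower :
  q ^ 2 / (x * y ^ 2 * w * z) * double_lambert q (q / x) (q / y) (q / z) (q / w)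
  = 1 / y * CSeries (fun n => CSeries (fun j =>
      lambert_term q x w (- Z.of_nat (S n))%Z
      * lambert_term q y z (- Z.of_nat (S n) - Z.of_nat j)%Z)).
Proof.
  destruct (geom_decay_mul_shift _ _ decay_g decay_h) as (a & b & Ha & Hb & Hgh).
  assert (c0 : q ^ 2 / (x * y ^ 2 * w * z) * (x * y * w * z / q ^ 2) = 1 / y)
    by (field; auto).
  rewrite <- c0, <- (Cmult_assoc _ _ (CSeries _)); f_equal.
  rewrite <- (iterated_sum_scal _ a b) by (assumption || (intros; apply Hgh; lia)).
  apply CSeries_ext; intros n; apply CSeries_ext; intros j.
  replace (- Z.of_nat (S n) - Z.of_nat j)%Z with (- Z.of_nat (S (n + j)))%Z by lia.
  rewrite !lambert_term_neg by assumption.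
  pose proof (lambert_den_neg_neq q w hq hw n) as Dw.
  pose proof (lambert_den_neg_neq q z hq hz (n + j)) as Dz.
  rewrite !Cpow_S in *.
  assert (Dw' : w - q * q ^ n <> 0) by (intros E; apply Dw;
    replace (q * q ^ n - w) with (- (w - q * q ^ n)) by ring; rewrite E; ring).
  assert (Dz' : z - q * q ^ (n + j) <> 0) by (intros E; apply Dz;
    replace (q * q ^ (n + j) - z) with (- (z - q * q ^ (n + j))) by ring; rewrite E; ring).
  field; repeat split; assumption.
Qed.

Hypothesis hxy : (Cmod (x * y) > Cmod q)%R.
Hypothesis hwz : forall k : nat, z - w * q ^ k <> 0.

(** Partial fractions in [u = q ^ n]:
    [(w - z q^-k) / ((1 - w u) (1 - z q^-k u)) = w / (1 - w u) - z q^-k / (1 - z q^-k u)]. *)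
Lemma lambert_term_mult (n : Z) (k : nat) :
  lambert_term q x w n * lambert_term q y z (n - Z.of_nat k)
  = - (w / z) * ((q / y) ^ k / (1 - w / z * q ^ k)) * lambert_term q (x * y) w n
    + x ^ k / (1 - w / z * q ^ k) * lambert_term q (x * y) z (n - Z.of_nat k).
Proof.
  pose proof (lambert_denZ_neq q w hq hw n) as Dw.
  pose proof (lambert_denZ_neq q z hq hz (n - Z.of_nat k)) as Dz.
  pose proof (Cpow_nz x k x0). pose proof (Cpow_nz y k y0). pose proof (Cpow_nz q k q0).
  specialize (hwz k).
  unfold lambert_term; unfold Cdiv at 5; rewrite Cpow_mult_l, Cpow_inv by exact y0.
  rewrite !CpowZ_sub_nat, !CpowZ_mult in * by (try apply Cmult_neq_0; assumption).
  rewrite Cpow_mult_l.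
  set (X := CpowZ x n) in *. set (Y := CpowZ y n) in *. set (Q := CpowZ q n) in *.
  set (Xk := x ^ k) in *. set (Yk := y ^ k) in *. set (Qk := q ^ k) in *.
  assert (Dz' : Qk - z * Q <> 0).
  { intros E; apply Dz.
    replace (1 - z * (Q / Qk)) with ((Qk - z * Q) / Qk) by (field; assumption).
    rewrite E; unfold Cdiv; apply Cmult_0_l. }
  field; repeat split; assumption.
Qed.

Lemma diagonal_sum :
  CSeries (fun k => CSeries_bilateral (fun n =>
    lambert_term q x w n * lambert_term q y z (n - Z.of_nat k)%Z))
  = lambert q x [w / z] * bilateral_lambert q (x * y) z
    - w / z * lambert q (q / y) [w / z] * bilateral_lambert q (x * y) w.
Proof.
  assert (hxy1 : (Cmod q < Cmod (x * y) < 1)%R).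
  { split; [exact hxy|]; rewrite Cmod_mult; nra. }
  assert (Bw : bisummable (lambert_term q (x * y) w))
    by now apply geom_decay_bisummable, lambert_term_decay.
  assert (Bz : bisummable (lambert_term q (x * y) z))
    by now apply geom_decay_bisummable, lambert_term_decay.
  assert (Hv : (Cmod (w / z * q) < 1)%R).
  { rewrite Cmod_mult, Cmod_div by exact z0.
    replace (Cmod w / Cmod z * Cmod q)%R with (Cmod w * Cmod q / Cmod z)%R by (field; lra).
    apply Rlt_div_l; [lra|]; nra. }
  assert (Hqy : (Cmod (q / y) < 1)%R)
    by (rewrite Cmod_div by exact y0; apply Rlt_div_l; lra).
  pose proof (lambert_summable q x (w / z) ltac:(lra) ltac:(lra) Hv) as Sx.
  pose proof (lambert_summable q (q / y) (w / z) ltac:(lra) Hqy Hv) as Sy.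
  rewrite !lambert_single.
  rewrite (CSeries_ext _ (fun k =>
      - (w / z) * bilateral_lambert q (x * y) w * ((q / y) ^ k / (1 - w / z * q ^ k))
      + bilateral_lambert q (x * y) z * (x ^ k / (1 - w / z * q ^ k)))).
  - rewrite CSeries_plus by now apply summable_scal.
    rewrite !CSeries_scal by assumption; ring.
  - intros k.
    destruct (CSeries_bilateral_shift _ (Z.of_nat k) Bz) as [Bzk Ezk].
    rewrite (CSeries_bilateral_ext _ _ (fun n => lambert_term_mult n k)).
    rewrite CSeries_bilateral_lin by assumption; rewrite Ezk.
    change (CSeries_bilateral (lambert_term q (x * y) z)) with (bilateral_lambert q (x * y) z).
    change (CSeries_bilateral (lambert_term q (x * y) w)) with (bilateral_lambert q (x * y) w).
    ring.
Qed.

End DoubleSeries.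

Theorem mainTheorem6 (q x y z w : C)
  (hq : (0 < Cmod q < 1)%R)
  (hx : (Cmod q < Cmod x < 1)%R)
  (hy : (Cmod q < Cmod y < 1)%R)
  (hz : (Cmod q < Cmod z < 1)%R)
  (hw : (Cmod q < Cmod w < 1)%R)
  (hxy : (Cmod (x * y) > Cmod q)%R)
  (hwz : forall r : nat, w <> z * CpowZ q (- Z.of_nat r)) :
  double_lambert q x y (z * q) w
    - q ^ 2 / (x * y ^ 2 * w * z)
      * double_lambert q (q / x) (q / y) (q / z) (q / w)
  = 1 / y * lambert q x [w] * bilateral_lambert q y z
    - 1 / y * lambert q x [w / z] * bilateral_lambert q (x * y) z
    + w / (y * z) * lambert q (q / y) [w / z] * bilateral_lambert q (x * y) w.
Proof.
  assert (hwz' : forall k : nat, z - w * q ^ k <> 0).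
  { intros k E; apply (hwz k); rewrite CpowZ_opp_of_nat.
    replace z with (w * q ^ k + (z - w * q ^ k)) by ring; rewrite E.
    field; apply Cpow_nz, Cmod_pos_neq_0; lra. }
  rewrite double_lambert_upper, double_lambert_lower by assumption.
  pose proof (half_plane_resummation _ _ (lambert_term_decay q w hq hw x hx)
                (lambert_term_decay q z hq hz y hy)) as H.
  rewrite diagonal_sum in H by assumption.
  rewrite (CSeries_ext _ _ (lambert_term_of_nat q w x)), <- lambert_single in H.
  change (CSeries_bilateral (lambert_term q y z)) with (bilateral_lambert q y z) in H.
  match goal with |- _ * ?a - _ * ?b = _ =>
    replace (1 / y * a - 1 / y * b) with (1 / y * (a - b)) by ring end.
  rewrite H; field; split; apply Cmod_pos_neq_0; lra.
Qed.
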